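(* Let $d\ge 1$ and $r\ge 2$ be integers and let $e_1,\dots,e_{r-1}\ge 2$ be integers with $\sum_{i=1}^{r-1}(e_i-1)=d-1$. Then the pure-cycle Hurwitz number satisfies $$h(d,r,0;e_1,\dots,e_{r-1},d)=d^{r-3}.$$
   Context: For $e\ge 2$, an $e$-cycle in the symmetric group $S_d$ is a permutation of cycle type $(e,1,\dots,1)$, i.e. a single cycle of length $e$ together with fixed points. Permutations are composed right-to-left: $(\mu\eta)(x)=\mu(\eta(x))$. For integers $e_1,\dots,e_r\ge 2$ satisfying $\sum_{i=1}^r(e_i-1)=2d-2+2g$, the pure-cycle Hurwitz number $h(d,r,g;e_1,\dots,e_r)$ is defined as the number of tuples $(\sigma_1,\dots,\sigma_r)\in S_d^r$ such that (a) each $\sigma_i$ is an $e_i$-cycle, (b) $\sigma_1\sigma_2\cdots\sigma_r=1$, and (c) $\sigma_1,\dots,\sigma_r$ generate a transitive subgroup of $S_d$, divided by $d!$. (Equivalently, it counts connected genus-$g$ degree-$d$ branched covers of the projective line with $r$ branch points, each having a single ramification point, of index $e_i$, weighted by inverse automorphism group orders.) *)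

(* Defs.v *)
From mathcomp Require Import all_boot all_order all_algebra fingroup perm action.

Set Implicit Arguments.
Unset Strict Implicit.
Unset Printing Implicit Defensive.

(* Lengths of all the cycles of [s], fixed points included. *)
Definition cycle_lengths (d : nat) (s : 'S_d) : seq nat :=
  [seq #|c| | c : {set 'I_d} in porbits s].

(* Cycle type (e, 1, ..., 1).  When [d < e] no permutation qualifies, because
   the cycle lengths always sum to [d]. *)
Definition is_ecycle (d e : nat) (s : 'S_d) : bool :=
  perm_eq (cycle_lengths s) (e :: nseq (d - e) 1).

(* The product of [{perm T}] composes left to right, [(s * t) x = t (s x)], so
   the right-to-left composite of s_1, ..., s_r is [s_r * ... * s_1]. *)
Definition rtl_prod (d : nat) (s : seq 'S_d) : 'S_d :=
  (\prod_(t <- rev s) t)%g.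

Definition generate_transitive (d : nat) (s : seq 'S_d) : bool :=
  [transitive <<[set t in s]>>, on [set: 'I_d] | 'P]%g.

Definition hurwitz_tuples (d r : nat) (e : seq nat) : {set r.-tuple 'S_d} :=
  [set s : r.-tuple 'S_d |
    [&& [forall i : 'I_r, is_ecycle (nth 0 e i) (tnth s i)],
        rtl_prod s == 1%g
      & generate_transitive s]].

(* The number is only defined for r indices e_i >= 2 satisfying
   sum (e_i - 1) = 2d - 2 + 2g; the value is 0 by convention otherwise.  The
   equation is written additively to avoid truncated subtraction at d = 0. *)
Definition pure_cycle_hurwitz (d r g : nat) (e : seq nat) : rat :=
  if [&& size e == r, all (leq 2) e &
         \sum_(x <- e) (x - 1) + 2 == 2 * d + 2 * g]
  then (#|hurwitz_tuples d r e|%:R / d`!%:R)%R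
  else 0%R.

(* Main.v *)
Require Import Defs.
From mathcomp Require Import all_boot all_order all_algebra.
From mathcomp Require Import fingroup perm action zify.

Set Implicit Arguments.
Unset Strict Implicit.
Unset Printing Implicit Defensive.

(* The last factor is the inverse of the product of the others, so one counts
   the tuples of e_i-cycles whose product is a d-cycle.  More generally, let p
   have c cycles of sizes b_1, ..., b_c, with c - 1 = sum_i (e_i - 1), and let
   N be the number of ways to reach a d-cycle from p by multiplying by
   e_i-cycles, i = 1, ..., k.  Then d N = (c - 1)! d^k b_1 ... b_c, by induction
   on k.  An e-cycle is a product of e - 1 transpositions (x y_j) with a common
   point x, and the number of cycles can only drop fast enough if each of them
   merges two cycles.  Merging the cycles in a set S replaces prod_(j in S) b_j
   by sum_(j in S) b_j, whose sum over all choices is computed explicitly. *)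

(** * Cycles as products of transpositions with a common point *)

Section CycleMerging.
Variable T : finType.
Implicit Types (s p : {perm T}) (x y z : T) (ys : seq T).
Local Open Scope group_scope.

(** Products act left to right, so for distinct entries this is the cycle x -> y_1 -> y_2 -> ... ->
    x. *)
Definition cyc x ys : {perm T} := \prod_(y <- ys) tperm x y.

Lemma cyc_cons x y ys : cyc x (y :: ys) = tperm x y * cyc x ys.
Proof. by rewrite /cyc big_cons. Qed.

Lemma cycE x ys z : uniq (x :: ys) -> cyc x ys z = next (x :: ys) z.
Proof.
elim: ys z => [|y ys IH] z /=.
  by rewrite /cyc big_nil perm1; case: eqP.
rewrite inE negb_or => /and3P[/andP[nxy nx] ny u].
rewrite cyc_cons permM IH /= ?nx //.
case: tpermP => [-> | -> | /eqP/negPf zx /eqP/negPf zy].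
- rewrite eqxx; have := next_nth (x :: ys) y.
  by rewrite inE eq_sym (negPf nxy) (negPf ny).
- rewrite eq_sym (negPf nxy); case: ys {nx ny u IH} => [|w ys] /=; rewrite ?eqxx //.
- by rewrite zx; case: ys {nx ny u IH} => [|w ys] /=; rewrite ?zx ?zy.
Qed.

(** * Effect of one transposition on the cycles *)

Lemma tperm_mul_tperm x y p : tperm x y * (tperm x y * p) = p.
Proof. by rewrite mulgA tperm2 mul1g. Qed.

Lemma porbit_stable p (A : {pred T}) x :
  (forall z, z \in A -> p z \in A) -> x \in A -> {subset porbit p x <= A}.
Proof.
move=> sA Ax z /porbitP[i ->]; elim: i => [|i IH]; first by rewrite expg0 perm1.
by rewrite expgSr permM sA.
Qed.

Lemma mem_porbit_perm p x z : (p z \in porbit p x) = (z \in porbit p x).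
Proof. by rewrite -!eq_porbit_mem -(porbit_perm p 1 z) expg1. Qed.

Lemma card_porbits_merge p x y : y \notin porbit p x ->
  #|porbits p| = #|porbits (tperm x y * p)|.+1.
Proof.
move=> yx; have := porbits_mul_tperm p x y.
rewrite porbit_sym yx; have -> : x != y by apply: contraNneq yx => <-; apply: porbit_id.
by rewrite /=; lia.
Qed.

(** A split adds a cycle, but y = x makes the transposition trivial, whence only an inequality. *)
Lemma card_porbits_split p x y : y \in porbit p x ->
  #|porbits p| <= #|porbits (tperm x y * p)|.
Proof.
by move=> yx; have := porbits_mul_tperm p x y; rewrite porbit_sym yx /=; lia.
Qed.

(** Otherwise a second use of the same transposition would lower the number of cycles again,
    although it gives back p. *)
Lemma mem_porbit_merge p x y : y \notin porbit p x ->
  y \in porbit (tperm x y * p) x.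
Proof.
move=> yx; apply/negPn/negP => /card_porbits_merge.
by rewrite tperm_mul_tperm (card_porbits_merge yx); lia.
Qed.

Lemma porbit_merge p x y : y \notin porbit p x ->
  porbit (tperm x y * p) x = porbit p x :|: porbit p y.
Proof.
move=> yx; have yx' := mem_porbit_merge yx; set q := tperm x y * p in yx' *.
apply/eqP; rewrite eqEsubset; apply/andP; split; apply/subsetP.
  apply: porbit_stable; last by rewrite inE porbit_id.
  move=> z zA; rewrite permM !inE !mem_porbit_perm -!in_setU.
  by case: tpermP zA => // _; rewrite !inE porbit_id ?orbT.
(* p and q differ by a transposition whose two points lie in the orbit of x under q, so this orbit
   is stable under p. *)
have qp z : z \in porbit q x -> p z \in porbit q x.
  have -> : p z = q (tperm x y z) by rewrite -permM tperm_mul_tperm.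
  by rewrite mem_porbit_perm; case: tpermP => // _ _; apply: porbit_id.
move=> z; rewrite inE => /orP[]; apply: porbit_stable => //.
exact: porbit_id.
Qed.

Lemma porbit_merge_notin p x y z : z \notin porbit p x -> z \notin porbit p y ->
  porbit (tperm x y * p) z = porbit p z.
Proof.
move=> zx zy.
have E i : ((tperm x y * p) ^+ i) z = (p ^+ i) z.
  elim: i => [|i IH]; first by rewrite !expg0.
  rewrite !expgSr !permM IH tpermD //.
    apply: contraNneq zx => ->; rewrite porbit_sym; exact: mem_porbit.
  apply: contraNneq zy => ->; rewrite porbit_sym; exact: mem_porbit.
by apply/setP=> w; apply/porbitP/porbitP => -[i ->]; exists i; rewrite E.
Qed.

(** * Cycle sizes, weights and sums over cycles *)

Definition oporbits p x := porbits p :\ porbit p x.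

Lemma card_oporbits p x : #|porbits p| = #|oporbits p x|.+1.
Proof. by rewrite (cardsD1 (porbit p x)) imset_f. Qed.

Lemma oporbitsP p x (C : {set T}) :
  reflect (exists2 z, z \notin porbit p x & C = porbit p z) (C \in oporbits p x).
Proof.
apply: (iffP setD1P) => [[Cx /imsetP[z _ Cz]] | [z zx ->]].
  by exists z => //; apply: contra Cx; rewrite Cz -eq_porbit_mem.
by rewrite imset_f // eq_porbit_mem.
Qed.

Lemma oporbits_merge p x y : y \notin porbit p x ->
  oporbits (tperm x y * p) x = oporbits p x :\ porbit p y.
Proof.
move=> yx; apply/setP => C; apply/oporbitsP/setD1P => [[z] | [Cy /oporbitsP[z zx Cz]]].
  rewrite porbit_merge // inE negb_or => /andP[zx zy] ->.
  rewrite porbit_merge_notin //; split; first by rewrite eq_porbit_mem.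
  by apply/oporbitsP; exists z.
have zy : z \notin porbit p y by rewrite -eq_porbit_mem -Cz.
by exists z; rewrite ?porbit_merge ?inE ?negb_or ?zx ?porbit_merge_notin.
Qed.

Definition oweight p x := (\prod_(C in oporbits p x) #|C|)%N.
Definition weight p := (\prod_(C in porbits p) #|C|)%N.

Lemma weightE p x : weight p = (#|porbit p x| * oweight p x)%N.
Proof. by rewrite /weight (big_setD1 (porbit p x)) ?imset_f. Qed.

Lemma card_porbit_merge p x y : y \notin porbit p x ->
  #|porbit (tperm x y * p) x| = #|porbit p x| + #|porbit p y|.
Proof.
move=> yx; rewrite porbit_merge // cardsU (_ : _ :&: _ = set0) ?cards0 ?subn0 //.
apply/setP => z; rewrite !inE; apply/negP => /andP[].
by rewrite -!eq_porbit_mem => /eqP-> xy; case/negP: yx; rewrite -eq_porbit_mem eq_sym.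
Qed.

Lemma porbits_partition p : partition (porbits p) [set: T].
Proof.
have := @preim_partitionP _ _ (porbit p) [set: T].
congr partition; apply/setP => C; apply/imsetP/imsetP => -[x _ ->]; exists x => //.
  by apply/setP => z; rewrite !inE eq_porbit_mem porbit_sym.
by apply/setP => z; rewrite !inE /= eq_porbit_mem porbit_sym.
Qed.

Lemma sum_card_oporbits p x :
  (\sum_(C in oporbits p x) #|C| = #|T| - #|porbit p x|)%N.
Proof.
have := card_partition (porbits_partition p).
rewrite cardsT (big_setD1 (porbit p x)) ?imset_f //= => ->.
by rewrite addKn.
Qed.

(** Each cycle C is the orbit of exactly its #|C| points. *)
Lemma sum_porbits p (f : {set T} -> nat) :
  (\sum_z f (porbit p z) = \sum_(C in porbits p) #|C| * f C)%N.
Proof.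
rewrite (partition_big_imset (porbit p)) /=; apply: eq_bigr => _ /imsetP[x _ ->].
under eq_bigr => z /eqP -> do [].
rewrite sum_nat_const; congr (_ * _)%N; apply: eq_card => z.
exact: eq_porbit_mem.
Qed.

Lemma sum_oporbits p x (f : {set T} -> nat) :
  (\sum_(z | z \notin porbit p x) f (porbit p z) =
   \sum_(C in oporbits p x) #|C| * f C)%N.
Proof.
(* The inequality, read as 0 or 1, removes the cycle of x from the sum. *)
have := sum_porbits p (fun C => (C != porbit p x) * f C)%N.
rewrite (big_setD1 (porbit p x)) ?imset_f //= eqxx mul0n muln0 add0n => E.
transitivity (\sum_z (porbit p z != porbit p x) * f (porbit p z))%N.
  rewrite big_mkcond; apply: eq_bigr => z _; rewrite eq_porbit_mem.
  by case: ifP; rewrite ?mul1n ?mul0n.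
by rewrite E; apply: eq_bigr => C; rewrite !inE => /andP[-> _]; rewrite mul1n.
Qed.

(** * Sums over successive mergings into one cycle *)

Lemma big_tuple_cons n (F : seq T -> nat) :
  (\sum_(t : n.+1.-tuple T) F t = \sum_y \sum_(t : n.-tuple T) F (y :: t))%N.
Proof.
rewrite pair_big (reindex (fun u : T * n.-tuple T => [tuple of u.1 :: u.2])) //=.
exists (fun t : n.+1.-tuple T => (thead t, [tuple of behead t])) => [[y t] _|t _] /=.
  by rewrite theadE; congr (_, _); apply: val_inj.
by rewrite [RHS]tuple_eta; apply: val_inj.
Qed.

(* The cycle is inverted so that the transpositions act on the left of [p] in
   the order in which they are listed, see [star_cons]. *)
Definition star x ys : {perm T} := (cyc x ys)^-1.

Lemma star_cons x y ys p : star x (y :: ys) * p = star x ys * (tperm x y * p).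
Proof. by rewrite /star cyc_cons invMg tpermV mulgA. Qed.

Lemma star_nil x p : star x [::] * p = p.
Proof. by rewrite /star /cyc big_nil invg1 mul1g. Qed.

Lemma card_porbits_star x ys p : #|porbits p| <= #|porbits (star x ys * p)| + size ys.
Proof.
elim: ys p => [|y ys IH] p; first by rewrite star_nil addn0.
rewrite star_cons; move: {IH}(IH (tperm x y * p)).
have [/card_porbits_split|/card_porbits_merge] := boolP (y \in porbit p x) => /=; lia.
Qed.

(** A transposition lowers the number of cycles by at most one, so here each of them merges: its y
    is outside the current cycle of x, which contains all the earlier ones. *)
Lemma merging_uniq x ys p : #|porbits (star x ys * p)| + size ys = #|porbits p| ->
  uniq ys /\ {in ys, forall z, z \notin porbit p x}.
Proof.
elim: ys p => [|y ys IH] p //; rewrite star_cons => H.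
have := card_porbits_star x ys (tperm x y * p).
have [/card_porbits_split|yx] := boolP (y \in porbit p x); first by move: H => /=; lia.
have c := card_porbits_merge yx => _.
have [|u a] := IH (tperm x y * p); first by move: H c => /=; lia.
split=> /=.
  rewrite u andbT; apply/negP => /a; rewrite porbit_merge // inE porbit_id orbT //.
move=> z; rewrite inE => /predU1P[->//|/a].
by rewrite porbit_merge // inE negb_or => /andP[].
Qed.

(** The weight of q when all m transpositions leading from p to q merge cycles, and 0 otherwise. *)
Definition merging_weight p m q := ((#|porbits q| + m == #|porbits p|) * weight q)%N.

(** Let the cycle of x have size a and let there be n others. The entries of [ys] choose distinct
    other cycles C_1, ..., C_m, each in prod #|C_i| ways, and such a choice contributes
    [oweight p x] times a + sum #|C_i|. There are n ^_ m choices, and a given cycle takes a given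
    place in n.-1 ^_ m.-1 of them. *)
Lemma sum_merging_weight_star m p x :
  (\sum_(ys : m.-tuple T) merging_weight p m (star x ys * p) =
   oweight p x * (#|oporbits p x| ^_ m * #|porbit p x|
     + m * #|oporbits p x|.-1 ^_ m.-1 * (#|T| - #|porbit p x|)))%N.
Proof.
elim: m p => [|m IH] p.
  rewrite (big_pred1 [tuple]) => [|t]; last by rewrite [t]tuple0; apply/esym/eqP.
  by rewrite star_nil /merging_weight addn0 eqxx mul1n (weightE p x) ffactn0; lia.
rewrite (big_tuple_cons _ (fun ys => merging_weight p m.+1 (star x ys * p))).
rewrite (bigID (fun y => y \in porbit p x)) /=.
(* If the first y is in the cycle of x, no cycle is lost, and the other m transpositions cannot lose
   m + 1. *)
rewrite big1 => [|y yx]; last first.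
  apply: big1 => ys _; rewrite star_cons /merging_weight.
  have := card_porbits_star x ys (tperm x y * p); rewrite size_tuple.
  by have := card_porbits_split yx; case: eqP => //; lia.
rewrite add0n; set n := #|oporbits p x|; set a := #|porbit p x|; set D := (_ - a)%N.
(* The second factor of the formula once C is merged: n drops by 1, and #|C| passes from D to a. *)
pose f (C : {set T}) := (n.-1 ^_ m * (a + #|C|) + m * n.-2 ^_ m.-1 * (D - #|C|))%N.
have H y : y \notin porbit p x ->
  (\sum_(ys : m.-tuple T) merging_weight p m.+1 (star x (y :: ys) * p) =
   oweight (tperm x y * p) x * f (porbit p y))%N.
  move=> yx; have c := card_porbits_merge yx.
  have := IH (tperm x y * p); rewrite (card_porbit_merge yx) subnDA -/a -/D.
  have -> : #|oporbits (tperm x y * p) x| = n.-1.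
    by have := card_oporbits p x; have := card_oporbits (tperm x y * p) x; rewrite /n; lia.
  move=> <-; apply: eq_bigr => ys _; rewrite star_cons /merging_weight c.
  by rewrite addnS eqSS.
rewrite (eq_bigr _ H) {IH H}.
pose g (C : {set T}) := (\prod_(E in oporbits p x :\ C) #|E| * f C)%N.
rewrite (eq_bigr (fun y => g (porbit p y))) => [|y yx]; last first.
  by rewrite /g /oweight oporbits_merge.
(* The #|C| choices of y in C restore the factor that the merging removes from [oweight]. *)
rewrite sum_oporbits (eq_bigr (fun C : {set T} => oweight p x * f C)%N) => [|C CO]; last first.
  by rewrite /g /oweight mulnA [in RHS](big_setD1 C).
rewrite -big_distrr /=; congr (_ * _)%N.
rewrite big_split -!big_distrr /= big_split /= sum_card_oporbits sum_nat_const.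
rewrite sumnB => [|C CO]; last first.
  by rewrite /D /a -sum_card_oporbits (big_setD1 C) //= leq_addr.
rewrite sum_nat_const sum_card_oporbits -/n -/a -/D ffactnS.
have -> : (n * D - D = n.-1 * D)%N by case: (n) => [|k] /=; lia.
case: m @f @g => [|m] f g; first by rewrite !ffactn0 /=; lia.
by rewrite [n.-1 ^_ m.+1]ffactnS /=; nia.
Qed.

(** The #|C| points x of a cycle C complete [oweight] to [weight]. Summing over the n + 1 cycles
    gives #|T| times n ^_ m + m n (n.-1 ^_ m.-1), which is (m + 1) n ^_ m. *)
Lemma sum_merging_weight m p :
  (\sum_x \sum_(ys : m.-tuple T) merging_weight p m (star x ys * p) =
   m.+1 * weight p * #|T| * #|porbits p|.-1 ^_ m)%N.
Proof.
pose n := #|porbits p|.-1.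
pose f (C : {set T}) := (\prod_(E in porbits p :\ C) #|E| * (n ^_ m * #|C|
     + m * n.-1 ^_ m.-1 * (#|T| - #|C|)))%N.
rewrite (eq_bigr (fun x => f (porbit p x))) => [|x _]; last first.
  by rewrite sum_merging_weight_star /f /n (card_oporbits p x).
rewrite sum_porbits.
rewrite (eq_bigr (fun C : {set T} => weight p * (n ^_ m * #|C|
     + m * n.-1 ^_ m.-1 * (#|T| - #|C|)))%N) => [|C CO]; last first.
  by rewrite /f mulnA /weight [in RHS](big_setD1 C).
rewrite -big_distrr /= big_split /= -!big_distrr /=.
have S := card_partition (porbits_partition p); rewrite cardsT in S.
rewrite sumnB => [|C CO]; last first.
  by rewrite S (big_setD1 C) //= leq_addr.
rewrite -S sum_nat_const -/n.
have -> : (#|porbits p| * #|T| - #|T| = n * #|T|)%N.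
  by rewrite /n; case: #|porbits p| => [|k]; rewrite ?mul0n // mulSn addKn.
case: m @f => [|m] f.
  by rewrite !ffactn0 !mul0n addn0 !mul1n muln1.
by rewrite [n ^_ m.+1]ffactnS /=; nia.
Qed.

End CycleMerging.

(** * Listing a cycle from any of its points *)

Section CyclePermutations.
Variable T : finType.
Implicit Types (s p : {perm T}) (x y z : T) (ys : seq T).
Local Open Scope group_scope.

Lemma cyc_traject x ys : uniq (x :: ys) -> ys = traject (cyc x ys) (cyc x ys x) (size ys).
Proof.
move=> u; set q := cyc x ys; have /= := cycle_next u.
rewrite (@eq_path _ _ (frel q)) => [|y z]; last by rewrite [RHS]/= /q cycE.
rewrite rcons_path => /andP[/fpathP[n ->] _].
by rewrite size_traject.
Qed.

Lemma porbit_cyc x ys : uniq (x :: ys) -> porbit (cyc x ys) x =i x :: ys.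
Proof.
move=> u z; apply/idP/idP.
  apply: porbit_stable; last exact: mem_head.
  by move=> w; rewrite cycE // mem_next.
rewrite {1}(cyc_traject u) => /(@trajectP _ _ _ (size ys).+1) [i _ ->].
by rewrite -permX mem_porbit.
Qed.

Lemma cyc_notin x ys z : uniq (x :: ys) -> z \notin x :: ys -> cyc x ys z = z.
Proof. by move=> u /negPf zn; rewrite cycE // next_nth zn. Qed.

Lemma traject_cyc q x m : #|porbit q x| = m.+1 ->
    {in [predC porbit q x], forall z, q z = z} ->
  uniq (x :: traject q (q x) m) /\ cyc x (traject q (q x) m) = q.
Proof.
move=> c fixq; have u := uniq_traject_porbit q x; rewrite c in u; split => //.
have fc : fcycle q (traject q x m.+1).
  rewrite /= -[X in rcons _ X](iter_porbit q x) c iterSr -trajectSr.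
  exact: fpath_traject.
apply/permP => z; rewrite cycE //.
have [zt|zt] := boolP (z \in x :: traject q (q x) m); first exact: nextE.
rewrite next_nth (negPf zt) fixq // !inE porbit_traject c; exact: zt.
Qed.

End CyclePermutations.

(** * Cycles of prescribed length *)

Section ECycles.
Variable d : nat.
Implicit Types (s p : 'S_d) (x y z : 'I_d).
Local Open Scope group_scope.

Lemma cycle_lengths_porbit s x :
  perm_eq (cycle_lengths s) (#|porbit s x| :: [seq #|C| | C : {set 'I_d} in oporbits s x]).
Proof.
rewrite /cycle_lengths /image_mem -(map_cons (fun C : {set 'I_d} => #|C|)).
apply: perm_map; apply: uniq_perm; rewrite /= ?enum_uniq //.
  by rewrite mem_enum !inE eqxx.
move=> C; rewrite inE !mem_enum !inE.
by case: eqP => // ->; rewrite imset_f.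
Qed.

Lemma is_ecycleP e s : reflect
  (exists2 x, #|porbit s x| = e & {in [predC porbit s x], forall y, s y = y})
  ((0 < e) && is_ecycle e s).
Proof.
apply: (iffP andP) => [[e0 H]|[x c fixs]].
  have : e \in cycle_lengths s by rewrite (perm_mem H) mem_head.
  case/mapP => C; rewrite mem_enum => /imsetP[x _ ->] ce.
  exists x => // y; rewrite !inE => yx.
  move: H; rewrite /is_ecycle (permPl (cycle_lengths_porbit s x)) ce perm_cons => /perm_mem H.
  have : #|porbit s y| \in nseq (d - #|porbit s x|) 1%N.
    by rewrite -H; apply: map_f; rewrite mem_enum; apply/oporbitsP; exists y.
  rewrite mem_nseq => /andP[_ /cards1P[z yz]].
  have : s y \in porbit s y by apply: (mem_porbit s 1).
  by have := porbit_id s y; rewrite yz !inE => /eqP-> /eqP.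
split; first by rewrite -c lt0n card_porbit_neq0.
rewrite /is_ecycle (permPl (cycle_lengths_porbit s x)) c perm_cons.
have O1 C : C \in oporbits s x -> #|C| = 1%N.
  case/oporbitsP => y yx ->; apply/eqP/cards1P; exists y.
  apply/eqP; rewrite eqEsubset sub1set porbit_id andbT; apply/subsetP.
  by apply: porbit_stable; rewrite ?inE // => z; rewrite !inE => /eqP->; rewrite fixs.
have -> : (d - e)%N = size [seq #|C| | C : {set 'I_d} in oporbits s x].
  rewrite size_map -cardE -c -[X in (X - _)%N](card_ord d) -sum_card_oporbits.
  by rewrite (eq_bigr _ O1) sum1_card.
rewrite (_ : nseq _ _ = [seq #|C| | C : {set 'I_d} in oporbits s x]) //.
apply/esym/all_pred1P/allP => _ /mapP[C CO ->] /=.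
by rewrite mem_enum in CO; rewrite O1.
Qed.

Lemma is_ecycleV e s : is_ecycle e s^-1 = is_ecycle e s.
Proof. by rewrite /is_ecycle /cycle_lengths porbitsV. Qed.

Lemma is_ecycle_cyc x (ys : seq 'I_d) : uniq (x :: ys) -> is_ecycle (size ys).+1 (cyc x ys).
Proof.
move=> u; suff /andP[]: (0 < (size ys).+1) && is_ecycle (size ys).+1 (cyc x ys) by [].
apply/is_ecycleP; exists x.
  by rewrite (eq_card (porbit_cyc u)) (card_uniqP u).
by move=> z; rewrite inE /= porbit_cyc // => /cyc_notin->.
Qed.

(** Each of the m + 1 points of the cycle can serve as the common point, and it determines the
    list. *)
Lemma card_star_repr m s : 0 < m -> is_ecycle m.+1 s ->
  #|[set u : 'I_d * m.-tuple 'I_d | uniq (u.1 :: u.2) && (star u.1 u.2 == s)]| = m.+1.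
Proof.
move=> m0; rewrite -is_ecycleV; set q := s^-1 => /(conj (ltn0Sn m))/andP/is_ecycleP[x0 c fixq].
pose g x := (x, Tuple (introT eqP (size_traject q (q x) m))).
rewrite -[RHS]c -(@card_imset _ _ g (mem (porbit q x0))) => [|x y []//].
apply: eq_card => -[x ys]; rewrite inE /=.
have -> : (star x ys == s) = (cyc x ys == q) by rewrite /star /q -(inj_eq invg_inj) invgK.
apply/andP/imsetP => [[u /eqP qE]|[y yx0 [-> ->]] /=]; last first.
  have yE : porbit q y = porbit q x0 by apply/eqP; rewrite eq_porbit_mem.
  have [|z zy|u E] := @traject_cyc _ q y m; last (by rewrite E; split); first by rewrite yE.
  by apply: fixq; move: zy; rewrite !inE yE.
have ysE : tval ys = traject q (q x) m.
  by rewrite [LHS](cyc_traject u) qE size_tuple.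
exists x; last by congr (_, _); apply: val_inj.
(* A point x outside the cycle is fixed by q, so the list, nonempty as m > 0, would begin with x
   again. *)
apply/negPn/negP => xx0; have qx : q x = x by apply: fixq; rewrite inE.
by move: u; rewrite ysE; case: (m) m0 => //= k _; rewrite qx mem_head.
Qed.
End ECycles.

(** * Counting the ways to reach a single cycle *)

Section Factorizations.
Variable d : nat.
Implicit Types (s p : 'S_d) (x y z : 'I_d) (es : seq nat).
Local Open Scope group_scope.

Lemma sum_ecycles m (f : 'S_d -> nat) : 0 < m ->
  (\sum_x \sum_(ys : m.-tuple 'I_d | uniq (x :: ys)) f (star x ys) =
   m.+1 * \sum_(s | is_ecycle m.+1 s) f s)%N.
Proof.
move=> m0; rewrite pair_big_dep /=.
rewrite (partition_big (fun u : 'I_d * m.-tuple 'I_d => star u.1 u.2)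
           (is_ecycle m.+1)) /=; last first.
  by move=> [x ys] u; rewrite is_ecycleV -[m in m.+1](size_tuple ys) is_ecycle_cyc.
rewrite big_distrr /=; apply: eq_bigr => s es.
rewrite (eq_bigr (fun=> f s)) => [|u /andP[_ /eqP->] //].
rewrite sum_nat_const -(card_star_repr m0 es) cardsE.
by congr (_ * _)%N; apply: eq_card => u.
Qed.

Lemma is_ecycle_star m s : 0 < m -> is_ecycle m.+1 s ->
  exists x, exists ys : m.-tuple 'I_d, s = star x ys.
Proof.
move=> m0 es; have : 0 < m.+1 by []; rewrite -(card_star_repr m0 es).
by case/card_gt0P => -[x ys]; rewrite inE => /andP[_ /eqP<-]; exists x, ys.
Qed.

Lemma card_porbits_ecycle m s p : 0 < m -> is_ecycle m.+1 s ->
  #|porbits p| <= #|porbits (s * p)| + m.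
Proof.
move=> m0 /(is_ecycle_star m0)[x [ys ->]].
by have := card_porbits_star x ys p; rewrite size_tuple.
Qed.

(* [nfact es p] counts the ways to turn [p] into a single cycle by successive
   left multiplications by e-cycles, e running through [es]. *)
Fixpoint nfact es p : nat :=
  if es is e :: es' then (\sum_(s | is_ecycle e s) nfact es' (s * p))%N
  else #|porbits p| == 1%N.

(** An e-cycle removes at most e - 1 cycles, so p has too many of them to end with one. *)
Lemma nfact_eq0 es p : all (leq 2) es ->
  (\sum_(e <- es) (e - 1)).+1 < #|porbits p| -> nfact es p = 0%N.
Proof.
elim: es p => [|e es IH] p /=; first by rewrite big_nil; case: #|_| => [|[]].
case: e => [|[|m]] //= aes; rewrite big_cons subn1 /= => lt.
apply: big1 => s hs; apply: IH => //.
rewrite -(ltn_add2r m.+1); apply: (leq_trans _ (card_porbits_ecycle p _ hs)) => //.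
by rewrite addSn addnC.
Qed.

(** In the induction, [sum_ecycles] turns the sum over e-cycles into one over stars, which
    [sum_merging_weight] evaluates; S! (S + m) ^_ m = (S + m)! then gives the factorial. *)
Lemma nfactE es p : all (leq 2) es ->
    #|porbits p| = (\sum_(e <- es) (e - 1)).+1 ->
  (d * nfact es p = #|porbits p|.-1`! * d ^ size es * weight p)%N.
Proof.
elim: es p => [|e es IH] p /=.
  rewrite big_nil => _ c; rewrite c /= !mul1n muln1 /weight.
  have := card_partition (porbits_partition p); rewrite cardsT card_ord => {1}->.
  by have /eqP/cards1P[C ->] := c; rewrite !big_set1.
case: e => [|[|m']] // /= aes; set m := m'.+1; have m0 : 0 < m by [].
rewrite big_cons subn1 /= -/m => c; set S := (\sum_(e <- es) _)%N in c.
pose K := (S`! * d ^ size es)%N.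
(* If s removes fewer than m cycles, both sides vanish by [nfact_eq0]; otherwise S + 1 cycles remain
   and induction applies. *)
have H s : is_ecycle m.+1 s -> (d * nfact es (s * p) = K * merging_weight p m (s * p))%N.
  move=> hs; have := card_porbits_ecycle p m0 hs; rewrite /merging_weight.
  case: eqP => [E _|/eqP ne le]; rewrite ?mul1n ?mul0n ?muln0.
    have E' : #|porbits (s * p)| = S.+1.
      by apply: (@addIn m); rewrite E c addSn addnC.
    by rewrite IH // E'.
  rewrite nfact_eq0 ?muln0 // -/S -(ltn_add2r m) addSn [(S + m)%N]addnC -c.
  by rewrite ltn_neqAle eq_sym; apply/andP.
(* The factor m + 1 accounts for the m + 1 stars equal to each e-cycle. *)
apply/eqP; rewrite -(eqn_pmul2l (ltn0Sn m)); apply/eqP.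
rewrite big_distrr /= (eq_bigr _ H) -big_distrr /= mulnCA.
rewrite -(sum_ecycles (fun s => merging_weight p m (s * p)) m0).
rewrite (eq_bigr (fun x => \sum_(ys : m.-tuple 'I_d) merging_weight p m (star x ys * p))%N).
  rewrite sum_merging_weight c /= card_ord expnS.
  rewrite -(ffact_fact (leq_addr S m)) addKn /K.
  by move: (_ ^_ _) S`! (d ^ _)%N (weight p) m.+1 => *; nia.
(* Lists with a repetition may be included, as their merging weight is 0 by [merging_uniq]. *)
move=> x _; rewrite big_mkcond; apply: eq_bigr => ys _.
rewrite /merging_weight; case: ifP => // /negP nu; case: eqP => // E; case: nu.
have [|u a] := @merging_uniq _ x ys p; first by rewrite size_tuple.
by rewrite /= u andbT; apply/negP => /a; rewrite porbit_id.
Qed.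

Lemma porbit1 x : porbit (1 : 'S_d) x = [set x].
Proof.
apply/setP => y; rewrite inE; apply/porbitP/eqP => [[i ->]|->].
  by rewrite expg1n perm1.
by exists 0%N; rewrite expg1n perm1.
Qed.

Lemma card_porbits1 : #|porbits (1 : 'S_d)| = d.
Proof.
rewrite card_imset ?card_ord // => x y; rewrite !porbit1; exact: set1_inj.
Qed.

Lemma weight1 : weight (1 : 'S_d) = 1%N.
Proof.
by apply: big1 => _ /imsetP[x _ ->]; rewrite porbit1 cards1.
Qed.

(** * Hurwitz tuples as factorizations *)

Lemma nfact_card es p : nfact es p =
  #|[set t : (size es).-tuple 'S_d | all2 (@is_ecycle d) es t
       && (#|porbits (rtl_prod t * p)| == 1%N)]|.
Proof.
rewrite -sum1dep_card big_mkcond /=.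
elim: es p => [|e es IH] p /=.
  rewrite (big_pred1 [tuple]) => [|t]; last by rewrite [t]tuple0; apply/esym/eqP.
  by rewrite /rtl_prod /= big_nil mul1g; case: eqP.
pose F (t : seq 'S_d) : nat := if all2 (@is_ecycle d) (e :: es) t
       && (#|porbits (rtl_prod t * p)| == 1%N) then 1%N else 0%N.
rewrite (big_tuple_cons _ F) big_mkcond /=; apply: eq_bigr => s _.
case: ifP => hs; last by rewrite big1 // => t _; rewrite /F /= hs.
rewrite IH; apply: eq_bigr => t _; rewrite /F /= hs /=.
(* The head s is the rightmost factor of [rtl_prod], hence the first one multiplied onto p. *)
by rewrite /rtl_prod rev_cons -cats1 big_cat big_seq1 /= mulgA.
Qed.

Lemma is_ecycle_full s : 0 < d -> is_ecycle d s = (#|porbits s| == 1%N).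
Proof.
move=> d0; apply/idP/idP => [/perm_size|/cards1P[C sC]].
  by rewrite size_map -cardE subnn /= => /eqP.
have := card_partition (porbits_partition s); rewrite cardsT card_ord sC big_set1 => dC.
suff /andP[]: (0 < d) && is_ecycle d s by [].
have x : 'I_d by exists 0%N.
have xC : porbit s x = C by apply/set1P; rewrite -sC imset_f.
have CT : C = setT by apply/eqP; rewrite eqEcard subsetT cardsT card_ord -dC leqnn.
by apply/is_ecycleP; exists x => [|y]; rewrite xC -?dC // CT !inE.
Qed.

(** The last entry must be the inverse of the product of the others, and it is a d-cycle exactly
    when that product has a single orbit. *)
Lemma card_hurwitz_tuples es : 0 < d ->
  #|hurwitz_tuples d (size es).+1 (rcons es d)| = nfact es 1.
Proof.
move=> d0; rewrite nfact_card.
set A := [set _ | _].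
pose f (t : (size es).-tuple 'S_d) := [tuple of rcons t (rtl_prod t)^-1].
have fI : injective f by move=> t u /(congr1 val)/rcons_inj[tu _]; apply: val_inj.
rewrite -(card_imset _ fI); apply: eq_card => s; rewrite inE.
have rtl_rcons (t : seq 'S_d) c : rtl_prod (rcons t c) = c * rtl_prod t.
  by rewrite /rtl_prod rev_rcons big_cons.
have ec (t : (size es).-tuple 'S_d) (c : 'S_d) :
  [forall i : 'I_(size es).+1, is_ecycle (nth 0%N (rcons es d) i) (tnth [tuple of rcons t c] i)]
   = all2 (@is_ecycle d) es t && is_ecycle d c.
  have szt : size es = size t by rewrite size_tuple.
  rewrite all2E -szt eqxx /= andbC -(all_rcons [pred xy | is_ecycle xy.1 xy.2] _ (d, c)).
  rewrite -zip_rcons //.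
  have szr : size (rcons es d) = size (rcons t c) by rewrite !size_rcons -szt.
  have szz : size (zip (rcons es d) (rcons t c)) = (size es).+1.
    by rewrite size_zip -szr minnn size_rcons.
  apply/forallP/(all_nthP (0%N, 1)) => /= H i.
    rewrite szz => lt; have := H (Ordinal lt).
    by rewrite (tnth_nth 1) /= nth_zip.
  by have := H i; rewrite szz ltn_ord nth_zip //= (tnth_nth 1) => ->.
have [t [c ->]] : exists t : (size es).-tuple 'S_d, exists c, s = [tuple of rcons t c].
  case: s => s hs; case/lastP: s hs => [//|t c] hs.
  have ht : size t == size es by rewrite size_rcons in hs.
  by exists (Tuple ht), c; apply: val_inj.
rewrite ec rtl_rcons is_ecycle_full //.
apply/and3P/imsetP => [[/andP[et c1] ct _]|[u]].
  have cE : c = (rtl_prod t)^-1 by apply: invg_inj; apply/eqP; rewrite invgK eq_invg_mul.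
  exists t; last by apply: val_inj; rewrite /= cE.
  by rewrite inE et mulg1 -porbitsV -cE.
rewrite inE mulg1 -porbitsV => /andP[eu u1] /(congr1 val)/rcons_inj[/val_inj-> ->].
split; rewrite ?eu ?mulVg //.
(* The powers of the last entry, a d-cycle, carry x to every point, which gives transitivity. *)
have x : 'I_d by exists 0%N.
apply/imsetP; exists x => //; apply/esym/setP => y; rewrite inE; apply/orbitP.
have /porbitP[i ->] : y \in porbit (rtl_prod u)^-1 x.
  have /cards1P[C sC] := u1; rewrite -eq_porbit_mem.
  have E z : porbit (rtl_prod u)^-1 z = C by apply/set1P; rewrite -sC imset_f.
  by rewrite !E.
exists ((rtl_prod u)^-1 ^+ i) => //.
by rewrite groupX // mem_gen // inE mem_rcons mem_head.
Qed.

End Factorizations.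

(** * The value of the Hurwitz number *)

Import GRing.Theory Num.Theory.

Theorem theorem1p2 (d r : nat) (e : (r - 1).-tuple nat) (hd : 1 <= d)
  (hr : 2 <= r) (he : forall i : 'I_(r - 1), 2 <= tnth e i)
  (hsum : \sum_(i < r - 1) (tnth e i - 1) = d - 1) :
  pure_cycle_hurwitz d r 0 (rcons e d) = ((d%:R : rat) ^ (r%:Z - 3%:Z))%R.
Proof.
have he2 : all (leq 2) e by apply/all_tnthP.
rewrite -(big_tuple _ _ e predT (fun x => x - 1)) in hsum.
have sze : size e = r - 1 by rewrite size_tuple.
case: e sze he2 hsum {he} => es _ /= sze he2 hsum.
have es0 : 0 < size es by lia.
have {hr sze} rE : r = (size es).+1 by lia.
(* Since r >= 2, some e_i >= 2 contributes to d - 1; so the last index d is admissible too. *)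
have d2 : 2 <= d.
  case: es es0 he2 hsum {rE} => //= e0 es _ /andP[e2 _].
  by rewrite big_cons; lia.
rewrite {}rE /pure_cycle_hurwitz size_rcons eqxx all_rcons d2 he2 /=.
rewrite -cats1 big_cat big_seq1 /= hsum cats1.
have -> : d - 1 + (d - 1) + 2 == 2 * d + 2 * 0 by apply/eqP; lia.
rewrite card_hurwitz_tuples //.
(* The identity has d cycles of size 1, so d N = (d - 1)! d^(r-1). *)
have := @nfactE d es 1%g he2; rewrite card_porbits1 hsum weight1 muln1 => N.
have {}N : d * nfact es (1%g : 'S_d) = d.-1`! * d ^ size es by apply: N; lia.
have dn0 : (d%:R != 0 :> rat)%R by rewrite pnatr_eq0; lia.
have fn0 : (d`!%:R != 0 :> rat)%R by rewrite pnatr_eq0 -lt0n fact_gt0.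
(* With r = k + 2 the exponent is k - 1, which is negative for k = 0; hence the form d^k / d. *)
case: (size es) es0 N => // k _ N.
have -> : (k.+2%:Z - 3%:Z = k%:Z - 1)%R by lia.
rewrite expfzDr // exprN1 -exprnP; apply/eqP; rewrite eqr_div //; apply/eqP.
rewrite -natrX -!natrM mulnC N; congr (_%:R)%R.
by rewrite -[in RHS](prednK hd) factS prednK // expnSr; lia.
Qed.
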